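(* Let $j\ge 2$ and $t\ge 2$ be integers, and let $G$ be a $j$-connected $K_{1,t}$-free graph. Then $G$ has a $2$-connected spanning subgraph with maximum degree at most $\max\{j,t\}$.
   Context: All graphs are finite, simple and undirected. A graph is $j$-connected if it has more than $j$ vertices and no deletion of fewer than $j$ vertices disconnects it. A graph is $K_{1,t}$-free if it contains no induced subgraph isomorphic to the complete bipartite graph $K_{1,t}$. *)

(* Defs.v *)
From mathcomp Require Import all_boot.

Set Implicit Arguments.
Unset Strict Implicit.
Unset Printing Implicit Defensive.

Record sgraph (V : finType) := SGraph {
  adj :> rel V;
  adj_sym : symmetric adj;
  adj_irr : irreflexive adj }.

Definition nbrs (V : finType) (G : sgraph V) (v : V) : {set V} :=
  [set w | G v w].

Definition max_degree (V : finType) (G : sgraph V) : nat :=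
  \max_(v : V) #|nbrs G v|.

(* G - S is represented on all of V, with the vertices of S isolated; its
   connectedness is only required between vertices outside S. *)
Definition delete (V : finType) (G : sgraph V) (S : {set V}) : rel V :=
  [rel x y | [&& x \notin S, y \notin S & G x y]].

Definition connected_without (V : finType) (G : sgraph V) (S : {set V}) : Prop :=
  forall x y : V, x \notin S -> y \notin S -> connect (delete G S) x y.

Definition k_connected (V : finType) (k : nat) (G : sgraph V) : Prop :=
  k < #|V| /\ forall S : {set V}, #|S| < k -> connected_without G S.

(* Spanning is automatic: both graphs have vertex set V. *)
Definition spanning_subgraph (V : finType) (H G : sgraph V) : Prop :=
  subrel H G.

Definition Kmn_adj (m n : nat) : rel ('I_m + 'I_n)%type :=
  fun x y => match x, y with
             | inl _, inr _ | inr _, inl _ => true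
             | _, _ => false
             end.

Lemma Kmn_sym m n : symmetric (@Kmn_adj m n).
Proof. by move=> [i|i] [k|k]. Qed.

Lemma Kmn_irr m n : irreflexive (@Kmn_adj m n).
Proof. by move=> [i|i]. Qed.

Definition complete_bipartite (m n : nat) : sgraph ('I_m + 'I_n)%type :=
  SGraph (@Kmn_sym m n) (@Kmn_irr m n).

(* f is an isomorphism from F onto the subgraph of G induced by its image. *)
Definition contains_induced (U V : finType) (F : sgraph U) (G : sgraph V) : Prop :=
  exists f : U -> V, injective f /\ forall x y : U, G (f x) (f y) = F x y.

Definition K1_free (V : finType) (t : nat) (G : sgraph V) : Prop :=
  ~ contains_induced (complete_bipartite 1 t) G.

(* Main.v *)
Require Import Defs.
From mathcomp Require Import all_boot.
From mathcomp Require Import zify.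

Set Implicit Arguments.
Unset Strict Implicit.
Unset Printing Implicit Defensive.

(** The subgraph is built greedily by ears.  Start from a single edge, and as
    long as the current subgraph [H] does not span [G], add an ear: a path of
    [G] between two distinct vertices of [H], with at least one inner vertex and
    all inner vertices outside [H].  Such an ear exists because [G] is
    2-connected.  At each step the ear is chosen inextensible: no vertex outside
    [H] and the ear is adjacent to two consecutive vertices of the ear (an ear
    of maximal length has this property, since such a vertex could be inserted).
    Every subgraph obtained stays connected after the deletion of any vertex,
    so the final one is 2-connected.

    For the degrees, let [v] be an inner vertex of an ear, let [u] be its
    predecessor on that ear, and let [x_1, ..., x_m] be the neighbours of [v] on
    the later ears that end at [v], in the order of their addition.  Then [v] has degree [m + 2].  When the ear
    through [v] was chosen, each [x_k] was outside, so it is not adjacent to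
    [u]; when the ear of [x_i] was chosen, each [x_k] with [i < k] was outside,
    so it is not adjacent to [x_i].  Hence [u, x_1, ..., x_m] are [m + 1]
    pairwise nonadjacent neighbours of [v], and [K_{1,t}]-freeness gives
    [m + 2 <= t].  The same count applies to the two ends of the initial edge,
    with the neighbours [x_1, ..., x_m] alone and degree [m + 1].

    The induction carries these independent sets along: this is the last clause
    of [partial_trestle].  Its preservation is [add_ear], the existence of ears
    is [ear_exists] and [inextensible_ear_exists], and the final count is
    [independent_lt].  Only 2-connectedness is needed, and the degree bound
    obtained is [t]. *)

(** * Independent neighbours *)

Lemma independent_lt (V : finType) (t : nat) (G : sgraph V) (v : V)
    (I : {set V}) :
  K1_free t G -> I \subset nbrs G v -> {in I &, forall x y, ~~ G x y} ->
  #|I| < t.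
Proof.
move=> hfree sIN indI; rewrite ltnNge; apply/negP => leI; apply: hfree.
pose e (i : 'I_t) : V := enum_val (widen_ord leI i).
have eI i : e i \in I by apply: enum_valP.
have Gve i : G v (e i) by have := subsetP sIN _ (eI i); rewrite inE.
have vNe i : v != e i by apply/eqP => E; have := Gve i; rewrite -E adj_irr.
exists (fun u => match u with inl _ => v | inr i => e i end); split.
  move=> [i|i] [k|k] /= E.
  - by rewrite [i]ord1 [k]ord1.
  - by have := vNe k; rewrite E eqxx.
  - by have := vNe i; rewrite E eqxx.
  - by move/enum_val_inj: E => /(congr1 val) /= E; congr inr; apply: val_inj.
move=> [i|i] [k|k] /=; first by rewrite adj_irr.
- exact: Gve.
- by rewrite adj_sym Gve.
- exact/negbTE/indI.
Qed.

(** * Ears *)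

Section Ears.
Variables (V : finType) (G : sgraph V).
Implicit Types (H : sgraph V) (A I : {set V}) (a b v x y z : V) (p s : seq V).

(** [x] and [y] are consecutive, in this order, on the sequence [p]; meant for
    duplicate-free [p], since [index] sees only first occurrences. *)
Definition seq_edge p : rel V :=
  fun x y => [&& x \in p, y \in p & index y p == (index x p).+1].

Definition add_seq_rel H p : rel V :=
  fun x y => [|| H x y, seq_edge p x y | seq_edge p y x].

Lemma add_seq_sym H p : symmetric (add_seq_rel H p).
Proof. by move=> x y; rewrite /add_seq_rel adj_sym [X in _ || X]orbC. Qed.

Lemma add_seq_irr H p : irreflexive (add_seq_rel H p).
Proof.
move=> x; rewrite /add_seq_rel adj_irr orbb /=.
by rewrite /seq_edge (ltn_eqF (ltnSn _)) !andbF.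
Qed.

(** The graph [H] with the edges of the path [p] added. *)
Definition add_seq H p : sgraph V := SGraph (add_seq_sym H p) (add_seq_irr H p).

(** The path [a], [s], [b] of [G] is an ear of the vertex set [A]: its ends [a]
    and [b] are distinct vertices of [A], and its inner vertices, listed by [s],
    are outside [A]; there is at least one of them. *)
Definition ear A a s b : Prop :=
  [/\ s != [::], path G a (rcons s b), uniq (a :: rcons s b),
      a \in A /\ b \in A & {in s, forall x, x \notin A}].

(** No vertex off [A] and off the ear can be inserted between two consecutive
    vertices of the ear.  The index [i] runs over all edges of the ear, from the
    one at [a] to the one at [b]. *)
Definition inextensible A a s b : Prop :=
  forall z i, z \notin A -> z \notin s -> i <= size s ->
    let p := a :: rcons s b in
    ~~ (G z (nth a p i) && G z (nth a p i.+1)).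

(** [I] is a set of pairwise nonadjacent [G]-neighbours of [v] inside [A],
    of size at least the degree of [v] in [H] minus one, such that adding to it any
    neighbour of [v] outside [A] leaves it independent. *)
Definition witness H A v I : Prop :=
  [/\ I \subset A :&: nbrs G v, {in I &, forall x y, ~~ G x y},
      (forall x z, x \in I -> z \notin A -> G v z -> ~~ G x z)
    & #|nbrs H v| <= #|I|.+1].

(** The invariant of the construction: [H] is a subgraph of [G] on the vertex set
    [A] that remains connected when any one vertex is deleted (a single edge
    qualifies), and each of its vertices has a witness for its degree. *)
Definition partial_trestle H A : Prop :=
  [/\ 1 < #|A|, subrel H G, (forall x y, H x y -> x \in A),
      (forall z x y, x \in A -> y \in A -> x != z -> y != z ->
         connect (delete H [set z]) x y)
    & forall v, v \in A -> exists I, witness H A v I].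

Lemma ear_exists A :
  (forall z, connected_without G [set z]) -> 1 < #|A| -> A != setT ->
  connected_without G set0 ->
  exists a s b, ear A a s b.
Proof.
move=> conG cardA AnT conG0.
have [y yA] : exists y, y \notin A.
  apply/existsP; apply: contraNT AnT; rewrite negb_exists => /forallP h.
  by apply/eqP/setP => x; rewrite inE; have := h x; rewrite negbK.
have [a0 a0A] : exists a, a \in A by apply/card_gt0P; apply: ltnW.
have cA : connect (delete G set0) a0 y by apply: conG0; rewrite inE.
have [a [x [aA xA Gax]]] : exists a x, [/\ a \in A, x \notin A & G a x].
  case/connectP: cA => q; elim: q a0 a0A => [|c q IH] a0 a0A /=.
    by move=> _ E; rewrite E a0A in yA.
  case/andP=> /and3P[_ _ Gac] pq lq.
  have [cA|cA] := boolP (c \in A); first exact: IH pq lq.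
  by exists a0, c.
have [b bA bNa] : exists2 b, b \in A & b != a.
  have : 0 < #|A :\ a| by move: cardA; rewrite (cardsD1 a) aA.
  by case/card_gt0P => b; rewrite !inE => /andP[? ?]; exists b.
have xNa : x != a by apply: contraNneq xA => ->.
have : connect (delete G [set a]) x b by apply: conG; rewrite inE.
case/connectP => q pq lq.
(* the walk from x is cut at its first vertex in A and then shortened *)
have {b bA bNa pq lq} [s [b [ps bA sA sa bNa]]] : exists s b,
    [/\ path G x (rcons s b), b \in A, {in s, forall u, u \notin A},
        a \notin s & b != a].
  elim: q x xA pq lq {Gax xNa} => [|c q IH] x xA /=.
    by move=> _ E; rewrite -E bA in xA.
  case/andP=> /and3P[_ cNa Gxc] pq lq; rewrite inE in cNa.
  have [cA'|cA'] := boolP (c \in A); first by exists [::], c; rewrite /= Gxc.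
  have [s [b' [ps b'A sA sa b'a]]] := IH c cA' pq lq.
  exists (c :: s), b'; split => //=; first by rewrite Gxc.
    by move=> u; rewrite inE => /predU1P[->|/sA].
  by rewrite inE eq_sym negb_or cNa.
have {ps} /andP[ps Gsb] : path G x s && G (last x s) b by rewrite -rcons_path.
case/shortenP: ps Gsb => s' ps' us' ss' Gsb.
exists a, (x :: s'), b.
have sA' : {in x :: s', forall u, u \notin A}.
  by move=> u; rewrite inE => /predU1P[->|/ss' /sA].
split => //.
- by rewrite /= Gax rcons_path ps' Gsb.
- rewrite cons_uniq rcons_uniq us' mem_rcons inE negb_or eq_sym bNa /= andbT.
  by apply/andP; split; apply/negP => /sA'; rewrite ?aA ?bA.
Qed.

(** A vertex adjacent to two consecutive vertices of an ear, the ones at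
    positions [i] and [i + 1], can be inserted between them. *)
Lemma ear_insert A a s b z i :
  ear A a s b -> z \notin A -> z \notin s -> i <= size s ->
  G z (nth a (a :: rcons s b) i) -> G z (nth a (a :: rcons s b) i.+1) ->
  ear A a (take i s ++ z :: drop i s) b.
Proof.
move=> [sn0 ps us [aA bA] sA] zA zs les G1 G2.
have G1' : G (last a (take i s)) z.
  rewrite adj_sym (last_nth a) size_takel //.
  suff -> : nth a (a :: take i s) i = nth a (a :: rcons s b) i by [].
  case: i les {G1 G2} => //= i les; rewrite nth_take // nth_rcons les.
  by [].
have {G2} G2' : G z (head b (drop i s)).
  move: G2; rewrite /= nth_rcons -nth0 nth_drop addn0.
  move: les; rewrite leq_eqVlt => /predU1P[->|les].
    by rewrite ltnn eqxx nth_default.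
  by rewrite les (set_nth_default b).
have perm : perm_eq (take i s ++ z :: drop i s) (z :: s).
  by rewrite -cat1s perm_catCA /= perm_cons cat_take_drop.
split => //.
- by case: (take i s).
- move: ps; rewrite -{1}[s](cat_take_drop i) !rcons_cat !cat_path /=.
  case/andP => -> /=; rewrite G1' /=.
  by case: (drop i s) G2' => [|c r] /= -> //= /andP[].
- move: us; rewrite !cons_uniq !mem_rcons !rcons_uniq !inE.
  rewrite (perm_uniq perm) !(perm_mem perm) cons_uniq zs !inE !negb_or.
  have -> : a != z by apply: contraNneq zA => <-.
  have -> : b != z by apply: contraNneq zA => <-.
  by [].
- by move=> u; rewrite (perm_mem perm) inE => /predU1P[->|/sA].
Qed.

Lemma inextensible_ear_exists A a s b :
  ear A a s b -> exists a s b, ear A a s b /\ inextensible A a s b.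
Proof.
have [n] := ubnP (#|V| - size s); elim: n s => // n IH s ltn E.
pose p := a :: rcons s b.
have [/existsP[z /existsP[i /and4P[zA zs G1 G2]]]|h] := boolP [exists z,
   exists i : 'I_(size s).+1, [&& z \notin A, z \notin s, G z (nth a p i)
      & G z (nth a p i.+1)]]; last first.
  exists a, s, b; split => // z i zA zs les /=; apply: contraNN h.
  case/andP=> G1 G2; apply/existsP; exists z; apply/existsP.
  by exists (Ordinal (les : i < (size s).+1)); apply/and4P.
apply: IH (ear_insert E zA zs (ltn_ord i) G1 G2).
case: E => _ _ us _ _.
have : size s < #|V|.
  have /card_uniqP cardp := us; have := max_card (mem (a :: rcons s b)).
  by rewrite cardp /= size_rcons; apply: ltnW.
rewrite size_cat /= addnS -size_cat cat_take_drop; move: ltn.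
by move: (size s) #|V| => m k; lia.
Qed.

(** * Adding an inextensible ear *)

Section AddEar.
Variables (H : sgraph V) (A : {set V}) (a b : V) (s : seq V).
Hypothesis HA : partial_trestle H A.
Hypothesis Es : ear A a s b.
Hypothesis Is : inextensible A a s b.

Let p := a :: rcons s b.
Let A' := A :|: [set x in s].
Let H' := add_seq H p.

Lemma size_ear : size p = (size s).+2.
Proof. by rewrite /= size_rcons. Qed.

Lemma uniq_ear : uniq p. Proof. by case: Es. Qed.

Lemma nth_ear_interior i : 0 < i <= size s -> nth a p i \in s.
Proof.
by case: i => //= i lis; rewrite nth_rcons lis mem_nth.
Qed.

Lemma nth_ear_last : nth a p (size s).+1 = b.
Proof. by rewrite /= nth_rcons ltnn eqxx. Qed.

Lemma ear_adj i : i <= size s -> G (nth a p i) (nth a p i.+1).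
Proof. by case: Es => _ /(pathP a) ps _ _ _ lis; apply: ps; rewrite size_rcons. Qed.

Lemma ear_notin x : x \in s -> x \notin A. Proof. by case: Es => _ _ _ _; apply. Qed.

Lemma ear_ends : a \in A /\ b \in A. Proof. by case: Es. Qed.

Lemma ear_mem x : x \in p -> x \in A'.
Proof.
have [aA bA] := ear_ends.
by rewrite !inE mem_rcons inE => /or3P[/eqP->|/eqP->|->]; rewrite ?aA ?bA ?orbT.
Qed.

Lemma ear_sub : subrel H' G.
Proof.
have edgeG x y : seq_edge p x y -> G x y.
  case/and3P => xp yp /eqP E; rewrite -(nth_index a xp) -(nth_index a yp) E.
  by apply: ear_adj; move: yp; rewrite -index_mem E size_ear.
move=> x y /or3P[|/edgeG //|/edgeG]; last by rewrite adj_sym.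
by case: HA => _ sHG _ _ _ /sHG.
Qed.

Lemma ear_supp x y : H' x y -> x \in A'.
Proof.
case/or3P=> [Hxy|/and3P[/ear_mem //]|/and3P[_ /ear_mem //]].
by case: HA => _ _ suppH _ _; rewrite inE (suppH _ _ Hxy).
Qed.

(** The part of the ear between positions [k] and [l] connects them, unless the
    deleted vertex [z] is on it. *)
Lemma connect_segment z k l : k <= l <= (size s).+1 ->
  (forall m, k <= m <= l -> nth a p m != z) ->
  connect (delete H' [set z]) (nth a p k) (nth a p l).
Proof.
case/andP=> lekl; elim: l lekl => [|l IH].
  by rewrite leqn0 => /eqP-> _ _; apply: connect0.
rewrite leq_eqVlt => /predU1P[-> _ _|lekl lels nz]; first exact: connect0.
apply: connect_trans (IH lekl (ltnW lels) _) _.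
  by move=> m hm; apply: nz; lia.
apply: connect1; apply/and3P; split; rewrite ?inE ?nz //; first lia.
  by rewrite leqnn andbT ltnW.
apply/or3P/Or32; rewrite /seq_edge !mem_nth ?size_ear ?ltnS ?(ltnW lels) //.
by rewrite !index_uniq ?uniq_ear ?size_ear ?ltnS ?(ltnW lels) ?eqxx.
Qed.

Lemma ear_connected z x y : x \in A' -> y \in A' -> x != z -> y != z ->
  connect (delete H' [set z]) x y.
Proof.
have [aA bA] := ear_ends.
have delC : connect_sym (delete H' [set z]).
  apply: sym_connect_sym => u v; rewrite /= [X in _ = X]andbCA; congr [&& _, _ & _].
  exact: adj_sym.
have toA u : u \in A' -> u != z ->
    exists2 w, w \in A /\ w != z & connect (delete H' [set z]) u w.
  rewrite inE => /orP[uA unz|]; first by exists u.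
  rewrite inE => us unz.
  have up : u \in p by rewrite inE mem_rcons inE us !orbT.
  pose i := index u p.
  have Eu : nth a p i = u by apply: nth_index.
  have lti : i < (size s).+2 by rewrite -size_ear index_mem.
  (* z lies on at most one of the two segments joining u to the ends *)
  have [zpre|zpre] := boolP (z \in take i p); last first.
    exists a; first split => //.
      apply: contraNneq zpre => <-.
      case: (i) Eu => [Eu|k _]; last by rewrite /= inE eqxx.
      by have := ear_notin us; rewrite -Eu aA.
    rewrite delC -Eu; apply: (connect_segment (k := 0)) => [|m /andP[_]].
      by rewrite -ltnS.
    rewrite leq_eqVlt => /predU1P[->|mi]; first by rewrite Eu.
    apply: contraNneq zpre => <-; rewrite -(nth_take a mi) mem_nth //.
    by rewrite size_takel // ltnW // size_ear.
  have zi : index z p < i by rewrite -in_take_leq // size_ear ltnW.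
  have zp : z \in p by apply: mem_take zpre.
  have nz m : i <= m <= (size s).+1 -> nth a p m != z.
    case/andP => im ms; apply: contraTneq zi => <-.
    by rewrite index_uniq ?uniq_ear ?size_ear // -leqNgt.
  exists b; first by split => //; rewrite -nth_ear_last nz // -ltnS lti leqnn.
  rewrite -Eu -nth_ear_last; apply: connect_segment => //.
  by rewrite leqnn andbT -ltnS.
move=> xA yA xz yz.
have [x' [x'A x'z] cx] := toA x xA xz; have [y' [y'A y'z] cy] := toA y yA yz.
apply: connect_trans cx _; rewrite delC; apply: connect_trans cy _.
case: HA => _ _ _ conH _; have := conH z y' x' y'A x'A y'z x'z.
apply: connect_sub => u v /and3P[uz vz Huv]; apply: connect1.
by apply/and3P; split => //; apply/or3P/Or31.
Qed.

Lemma index_ear_end v : v \in A -> v \in p ->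
  index v p = 0 \/ index v p = (size s).+1.
Proof.
move=> vA vp; have := vp; rewrite -index_mem size_ear => lti.
have [i0|i0] := posnP (index v p); first by left.
have [lei|] := leqP (index v p) (size s); last by right; lia.
have /ear_notin : nth a p (index v p) \in s by apply: nth_ear_interior; lia.
by rewrite nth_index // vA.
Qed.

(** At an end [v] of the ear, the witness grows by the neighbour [x] of [v] on
    the ear. *)
Lemma witness_end v x I : witness H A v I -> x \in s -> G v x ->
  nbrs H' v \subset x |: nbrs H v ->
  (forall z, z \notin A' -> G v z -> ~~ G x z) ->
  witness H' A' v (x |: I).
Proof.
case=> sIA indI outI degI xs Gvx subN outx.
have xA := ear_notin xs.
have IA y : y \in I -> (y \in A) /\ G v y.
  by move=> yI; have := subsetP sIA y yI; rewrite !inE => /andP[].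
have xI : x \notin I by apply: contraNN xA => /IA[].
split.
- apply/subsetP => y /setU1P[->|/IA[yA Gvy]]; rewrite !inE ?xs ?Gvx ?orbT //.
  by rewrite yA Gvy.
- move=> y z /setU1P[->|yI] /setU1P[->|zI]; first by rewrite adj_irr.
  + by rewrite adj_sym outI.
  + exact: outI.
  + exact: indI.
- move=> y z /setU1P[->|yI] zA' Gvz; first exact: outx.
  by apply: outI => //; apply: contraNN zA'; rewrite inE => ->.
- apply: leq_trans (subset_leq_card subN) _.
  by rewrite !cardsU1 xI add1n; case: (x \notin _) => /=; lia.
Qed.

Lemma outside_ear z i : z \notin A' -> i <= size s ->
  ~~ (G z (nth a p i) && G z (nth a p i.+1)).
Proof. by rewrite !inE negb_or => /andP[zA zs] lis; apply: Is. Qed.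

Lemma ear_witness v : v \in A' -> exists I, witness H' A' v I.
Proof.
have [aA bA] := ear_ends.
have s0 : 0 < size s by case: Es; case: (s).
have nbrP w : w \in p -> forall u, u \in nbrs H' w ->
   [\/ u \in nbrs H w, u = nth a p (index w p).+1 /\ (index w p) <= size s
     | u = nth a p (index w p).-1 /\ 0 < index w p].
  move=> wp u; rewrite inE => /or3P[Hwu||]; first by apply: Or31; rewrite inE.
  - case/and3P=> _ up /eqP E; apply: Or32; rewrite -E nth_index //; split=> //.
    by move: up; rewrite -index_mem size_ear E.
  - by case/and3P=> up _ /eqP E; apply: Or33; rewrite E nth_index.
rewrite inE => /orP[vA|].
  case: HA => _ _ _ _ /(_ v vA)[I WI].
  have [vp|vp] := boolP (v \in p); last first.
    exists I; case: WI => sIA indI outI degI; split => //.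
    - apply: subset_trans sIA _; apply/subsetP => y; rewrite !inE.
      by case/andP=> -> ->.
    - move=> x z xI zA'; apply: outI => //; apply: contraNN zA'.
      by rewrite inE => ->.
    - suff -> : nbrs H' v = nbrs H v by [].
      apply/setP => u; rewrite !inE /= /add_seq_rel /seq_edge (negbTE vp).
      by rewrite andbF !orbF.
  have Ev := nth_index a vp.
  (* v is the first or the last vertex of the ear *)
  case: (index_ear_end vA vp) => iv; rewrite iv in Ev.
    exists (nth a p 1 |: I); apply: witness_end => //.
    - exact: nth_ear_interior.
    - by rewrite -{1}Ev; apply: ear_adj.
    - apply/subsetP => u /nbrP - /(_ vp); rewrite iv => -[uH|[-> _]|[]//].
        by rewrite inE uH orbT.
      by rewrite !inE eqxx.
    - move=> z zA' Gvz; have := outside_ear zA' (leq0n _).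
      by rewrite Ev [G z v]adj_sym Gvz /= adj_sym.
  exists (nth a p (size s) |: I); apply: witness_end => //.
  - by apply: nth_ear_interior; rewrite s0 leqnn.
  - by rewrite -{1}Ev adj_sym; apply: ear_adj.
  - apply/subsetP => u /nbrP - /(_ vp); rewrite iv => -[uH|[_]|[-> _]].
    + by rewrite inE uH orbT.
    + by rewrite ltnn.
    + by rewrite !inE eqxx.
  - move=> z zA' Gvz; have := outside_ear zA' (leqnn _).
    by rewrite Ev [G z v]adj_sym Gvz andbT adj_sym.
rewrite inE => vs.
have vp : v \in p by rewrite inE mem_rcons inE vs !orbT.
have vA := ear_notin vs.
have Ev := nth_index a vp.
have nbrH0 u : u \notin nbrs H v.
  rewrite inE; apply: contraNN vA.
  by case: HA => _ _ suppH _ _; apply: suppH.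
(* v is an inner vertex of the ear: its only neighbours are its predecessor and
   its successor there, and its witness is the predecessor *)
case Ei: (index v p) => [|i]; first by rewrite -Ev Ei aA in vA.
have lti : i <= size s.
  by have := vp; rewrite -index_mem size_ear Ei.
have Gv : G v (nth a p i) by rewrite -{1}Ev Ei adj_sym ear_adj.
exists [set nth a p i]; split.
- rewrite sub1set in_setI [_ \in nbrs G v]inE Gv andbT ear_mem //.
  by rewrite mem_nth // size_ear; lia.
- by move=> x y /set1P-> /set1P->; rewrite adj_irr.
- move=> x z /set1P-> zA' Gvz; have := outside_ear zA' lti.
  by rewrite -Ei Ev [G z v]adj_sym Gvz andbT adj_sym.
- rewrite cards1; apply: leq_trans (subset_leq_card _) _.
    instantiate (1 := [set nth a p i; nth a p i.+2]).
  apply/subsetP => u /nbrP - /(_ vp); rewrite Ei => -[uH|[-> _]|[-> _]].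
  + by have := nbrH0 u; rewrite uH.
  + by rewrite !inE eqxx orbT.
  + by rewrite !inE eqxx.
  + by rewrite cards2; case: (_ != _).
Qed.

Lemma add_ear : partial_trestle H' A'.
Proof.
split.
- case: HA => c2 _ _ _ _; apply: leq_trans c2 _.
  exact/subset_leq_card/subsetUl.
- exact: ear_sub.
- exact: ear_supp.
- exact: ear_connected.
- exact: ear_witness.
Qed.

End AddEar.

End Ears.

(** * The construction *)

Lemma edge_exists (V : finType) (G : sgraph V) :
  1 < #|V| -> connected_without G set0 -> exists a b, G a b.
Proof.
case/card_gt1P => x [y [_ _ xy]] conG.
have : connect (delete G set0) x y by apply: conG; rewrite inE.
case/connectP => -[|c q] /=; first by move=> _ E; rewrite E eqxx in xy.
by case/andP => /and3P[_ _ Gxc] _ _; exists x, c.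
Qed.

(** Adjacency in the graph whose only edge joins [a] and [b]; empty when
    [a = b], so that the graph is simple. *)
Definition single_edge (V : finType) (a b : V) : rel V :=
  fun x y => (a != b) && ((x == a) && (y == b) || (x == b) && (y == a)).

Lemma single_edge_sym (V : finType) (a b : V) : symmetric (single_edge a b).
Proof.
by move=> x y; rewrite /single_edge orbC [(x == b) && _]andbC [(x == a) && _]andbC.
Qed.

Lemma single_edge_irr (V : finType) (a b : V) : irreflexive (single_edge a b).
Proof.
move=> x; rewrite /single_edge [(x == b) && _]andbC orbb.
by have [//|nab] := eqVneq a b; case: eqVneq => //= ->; rewrite (negbTE nab).
Qed.

Definition edge_graph (V : finType) (a b : V) : sgraph V :=
  SGraph (@single_edge_sym V a b) (@single_edge_irr V a b).

Lemma edge_partial_trestle (V : finType) (G : sgraph V) (a b : V) :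
  G a b -> partial_trestle G (edge_graph a b) [set a; b].
Proof.
move=> Gab; have nab : a != b by apply: contraTneq Gab => ->; rewrite adj_irr.
split.
- by rewrite cards2 nab.
- by move=> x y /andP[_ /orP[]/andP[/eqP-> /eqP->]] //; rewrite adj_sym.
- by move=> x y /andP[_ /orP[]/andP[/eqP-> _]]; rewrite !inE eqxx ?orbT.
- move=> z x y xA yA xz yz; have [->|nxy] := eqVneq x y; first exact: connect0.
  apply: connect1; apply/and3P; split; rewrite ?inE //=.
  rewrite /single_edge nab /=.
  move: xA yA nxy; rewrite !inE.
  by case/orP=> /eqP-> /orP[]/eqP->; rewrite ?eqxx ?orbT.
- move=> v vA; exists set0; split.
  + exact: sub0set.
  + by move=> x y; rewrite inE.
  + by move=> x z; rewrite inE.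
  + rewrite cards0; apply: leq_trans (subset_leq_card _) _.
      instantiate (1 := [set if v == a then b else a]).
      apply/subsetP => u; rewrite !inE /= /single_edge nab /=.
      case/orP => /andP[/eqP-> /eqP->]; rewrite ?eqxx //.
      by rewrite [b == a]eq_sym (negbTE nab).
    by rewrite cards1.
Qed.

(** Each added ear has an inner vertex, so the number of uncovered vertices
    decreases until there are none. *)
Lemma spanning_trestle (V : finType) (G H : sgraph V) (A : {set V}) :
  (forall z, connected_without G [set z]) -> connected_without G set0 ->
  partial_trestle G H A -> exists H', partial_trestle G H' setT.
Proof.
move=> conG conG0; have [n] := ubnP #|~: A|.
elim: n A H => // n IH A H ltn HA.
have [<-|AnT] := eqVneq A setT; first by exists H.
have c2 : 1 < #|A| by case: HA.
have [a [s [b E]]] := ear_exists conG c2 AnT conG0.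
have {a s b E} [a [s [b [E ine]]]] := inextensible_ear_exists E.
apply: IH (add_ear HA E ine); rewrite ltnS in ltn; apply: leq_trans ltn.
apply: proper_card; rewrite setCU; apply/properP; split; first exact: subsetIl.
case: E => sn0 _ _ _ sA; case: s sn0 sA {ine} => // x s _ sA.
by exists x; rewrite !inE ?eqxx ?andbF // sA ?mem_head.
Qed.

Theorem corollary3 (j t : nat) (hj : 2 <= j) (ht : 2 <= t)
    (V : finType) (G : sgraph V)
    (hG : k_connected j G) (hfree : K1_free t G) :
  exists H : sgraph V,
    spanning_subgraph H G /\ k_connected 2 H /\ max_degree H <= maxn j t.
Proof.
case: hG => cardV conG.
have conG0 : connected_without G set0 by apply: conG; rewrite cards0 ltnW.
have conG1 z : connected_without G [set z] by apply: conG; rewrite cards1.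
have c2 : 2 < #|V| := leq_ltn_trans hj cardV.
have [a [b Gab]] := edge_exists (ltnW c2) conG0.
have [H [_ sHG _ conH wH]] :=
  spanning_trestle conG1 conG0 (edge_partial_trestle Gab).
exists H; split; first exact: sHG.
split.
  split=> // S S1 x y xS yS.
  (* S is contained in a singleton that avoids x and y *)
  have [z [xz yz Sz]] : exists z, [/\ x != z, y != z & S \subset [set z]].
    have [S0|[z zS]] := set_0Vmem S; last first.
      exists z; split; first by apply: contraNneq xS => ->.
        by apply: contraNneq yS => ->.
      suff /eqP <- : [set z] == S by [].
      by rewrite eqEcard sub1set zS cards1.
    have : 0 < #|~: [set x; y]| by rewrite cardsCs setCK cards2; case: (_ != _); lia.
    case/card_gt0P => z; rewrite !inE negb_or => /andP[zx zy].
    by exists z; rewrite S0 sub0set ![_ == z]eq_sym.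
  apply: connect_sub (conH z x y _ _ xz yz) => // u v /and3P[uz vz Huv].
  apply: connect1; apply/and3P; split => //.
    by apply: contraNN uz; apply: (subsetP Sz).
  by apply: contraNN vz; apply: (subsetP Sz).
apply: leq_trans (leq_maxr j t); apply/bigmax_leqP => v _.
have [//|I [sI indI _ degI]] := wH v.
apply: leq_trans degI (independent_lt hfree _ indI).
by apply: subset_trans sI (subsetIr _ _).
Qed.
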